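(* Let $n\ge1$. For every orientation $\mathcal M$ of the cube matroid $M(C^n)$ there is a subset $A\subseteq C^n$ such that the reorientation ${}_{-A}\mathcal M$, with signed circuits $\mathcal C'$ and signed cocircuits $\mathcal D'$, satisfies $\mathcal F\subseteq\mathcal D'$, equivalently $\mathcal R\subseteq\mathcal C'$.
   Context: $C^n=\{-1,1\}^n\subseteq\mathbb R^n$, $[n]=\{1,\dots,n\}$. The cube matroid $M(C^n)$ is the matroid on $C^n$ whose independent sets are the affinely independent subsets over $\mathbb R$; an orientation of it is an oriented matroid with underlying matroid $M(C^n)$. For $A$ a subset of the ground set, ${}_{-A}\mathcal M$ is obtained by reversing the signs of the elements of $A$ in all signed circuits and cocircuits. For $\mathbf v\in C^n$ and $I\subseteq[n]$, ${}_{-I}\mathbf v$ is the vertex obtained by negating the coordinates of $\mathbf v$ indexed by $I$; ${}_{-IJ}\mathbf v={}_{-(I\cup J)}\mathbf v$ for disjoint $I,J$. For $i\in[n]$, $\epsilon\in\{-1,1\}$, $H_{\epsilon i}=\{\mathbf v\in C^n:v_i=\epsilon\}$. $\mathcal F$ is the family of signed sets $(H_{\epsilon i},\emptyset)$ and $(\emptyset,H_{\epsilon i})$, $i\in[n]$, $\epsilon\in\{-1,1\}$. $\mathcal R$ is the family of signed sets $\pm R(\mathbf v;I,J)$ with $\mathbf v\in C^n$, $I,J$ disjoint nonempty subsets of $[n]$, and $R(\mathbf v;I,J)=(\{\mathbf v,{}_{-IJ}\mathbf v\},\{{}_{-I}\mathbf v,{}_{-J}\mathbf v\})$. *)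

(* Defs.v *)
From mathcomp Require Import all_boot all_order all_algebra reals.
Set Implicit Arguments.
Unset Strict Implicit.
Unset Printing Implicit Defensive.
Import GRing.Theory.

(* A signed set X is the pair (X+, X-); disjointness of the two parts is       *)
(* imposed where signed circuits and cocircuits are defined.                   *)
Notation signed_set E := ({set E} * {set E})%type.

Section SignedSets.
Variable E : finType.
Implicit Types (X Y : signed_set E) (A : {set E}).

Definition sopp X : signed_set E := (X.2, X.1).

Definition supp X : {set E} := X.1 :|: X.2.

Definition sreorient A X : signed_set E :=
  ((X.1 :\: A) :|: (X.2 :&: A), (X.2 :\: A) :|: (X.1 :&: A)).

(* Either the supports are disjoint, or X and Y agree in sign at some common   *)
(* element and disagree in sign at another one.                                *)
Definition sorthogonal X Y : bool :=
  ((X.1 :&: Y.1) :|: (X.2 :&: Y.2) != set0) ==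
  ((X.1 :&: Y.2) :|: (X.2 :&: Y.1) != set0).

End SignedSets.

Record oriented_matroid (E : finType) := OrientedMatroid {
  circuits : {set signed_set E};
  circuit_disjoint : forall X, X \in circuits -> [disjoint X.1 & X.2];
  circuit_neq0 : (set0, set0) \notin circuits;
  circuit_opp : forall X, X \in circuits -> sopp X \in circuits;
  circuit_incomparable : forall X Y, X \in circuits -> Y \in circuits ->
    supp X \subset supp Y -> X = Y \/ X = sopp Y;
  circuit_elimination : forall X Y e, X \in circuits -> Y \in circuits ->
    X <> sopp Y -> e \in X.1 :&: Y.2 ->
    exists Z, [/\ Z \in circuits,
                  Z.1 \subset (X.1 :|: Y.1) :\ e
                & Z.2 \subset (X.2 :|: Y.2) :\ e]
}.

Section OrientedMatroids.
Variable E : finType.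
Implicit Types (M : oriented_matroid E) (S A B D : {set E}) (X Y : signed_set E).

(* Independent sets, bases and cocircuits of the underlying matroid, whose     *)
(* circuits are the supports of the signed circuits.                           *)
Definition independent M S : bool :=
  [forall X in circuits M, ~~ (supp X \subset S)].

Definition basis M B : bool := maxset (independent M) B.

Definition underlying_cocircuit M D : bool :=
  minset (fun D' => [forall B, basis M B ==> (B :&: D' != set0)]) D.

(* The unique signature of the cocircuits of the underlying matroid that is    *)
(* orthogonal to the signed circuits, i.e. the signed circuits of the dual.    *)
Definition cocircuits M : {set signed_set E} :=
  [set Y : signed_set E | [&& [disjoint Y.1 & Y.2], underlying_cocircuit M (supp Y)
             & [forall X in circuits M, sorthogonal X Y]]].

Lemma sreorientK A : involutive (@sreorient E A).
Proof.
move=> [P N]; congr pair; apply/setP=> x; rewrite !inE /=;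
  by case: (x \in A); rewrite ?(andbF, andbT, orbF, orbT).
Qed.

Lemma sreorient_opp A X : sreorient A (sopp X) = sopp (sreorient A X).
Proof. by []. Qed.

Lemma supp_sreorient A X : supp (sreorient A X) = supp X.
Proof.
apply/setP=> x; rewrite !inE /=.
by case: (x \in A); rewrite ?(andbF, andbT, orbF, orbT) //= orbC.
Qed.

Lemma disjoint_sreorient A X :
  [disjoint (sreorient A X).1 & (sreorient A X).2] = [disjoint X.1 & X.2].
Proof.
rewrite -!setI_eq0; congr (_ == _); apply/setP=> x; rewrite !inE /=.
by case: (x \in A); rewrite ?(andbF, andbT, orbF, orbT) //= andbC.
Qed.

Lemma sorthogonal_sreorient A X Y :
  sorthogonal (sreorient A X) (sreorient A Y) = sorthogonal X Y.
Proof.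
rewrite /sorthogonal; set P := _ :|: _; set N := _ :|: _.
suff [-> ->] : P = X.1 :&: Y.1 :|: X.2 :&: Y.2 /\
               N = X.1 :&: Y.2 :|: X.2 :&: Y.1 by [].
by split; apply/setP=> x; rewrite !inE /=; case: (x \in A);
  rewrite ?(andbF, andbT, orbF, orbT) //= orbC.
Qed.

Lemma mem_sreorient A (C : {set signed_set E}) X :
  (X \in sreorient A @: C) = (sreorient A X \in C).
Proof. by rewrite -{1}[X](sreorientK A) mem_imset //; exact: inv_inj (sreorientK A). Qed.

End OrientedMatroids.

Section Reorientation.
Variables (E : finType) (A : {set E}) (M : oriented_matroid E).
Let C := sreorient A @: circuits M.

Let C_disjoint X : X \in C -> [disjoint X.1 & X.2].
Proof. by rewrite mem_sreorient -(disjoint_sreorient A); apply: circuit_disjoint. Qed.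

Let C_neq0 : (set0, set0) \notin C.
Proof. by rewrite mem_sreorient /sreorient /= set0D set0I setU0 circuit_neq0. Qed.

Let C_opp X : X \in C -> sopp X \in C.
Proof. by rewrite !mem_sreorient sreorient_opp; apply: circuit_opp. Qed.

Let C_incomparable X Y : X \in C -> Y \in C ->
  supp X \subset supp Y -> X = Y \/ X = sopp Y.
Proof.
rewrite !mem_sreorient -(supp_sreorient A X) -(supp_sreorient A Y) => CX CY sXY.
have [eXY|eXY] := circuit_incomparable CX CY sXY; [left|right];
  by apply: (inv_inj (sreorientK A)).
Qed.

Let C_elimination X Y e : X \in C -> Y \in C -> X <> sopp Y ->
  e \in X.1 :&: Y.2 ->
  exists Z, [/\ Z \in C, Z.1 \subset (X.1 :|: Y.1) :\ e
                       & Z.2 \subset (X.2 :|: Y.2) :\ e].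
Proof.
rewrite !mem_sreorient => CX CY nXY eXY.
have nXY' : sreorient A X <> sopp (sreorient A Y).
  by rewrite -sreorient_opp => /(inv_inj (sreorientK A)).
have [Z [CZ sZ1 sZ2]] : exists Z, [/\ Z \in circuits M,
    Z.1 \subset ((sreorient A X).1 :|: (sreorient A Y).1) :\ e
  & Z.2 \subset ((sreorient A X).2 :|: (sreorient A Y).2) :\ e].
  have [eA|eA] := boolP (e \in A).
    have nYX : sreorient A Y <> sopp (sreorient A X).
      by move=> h; apply: nXY'; rewrite h; case: (sreorient A X).
    have eYX : e \in (sreorient A Y).1 :&: (sreorient A X).2.
      by move: eXY; rewrite !inE eA !andbT /= => /andP[-> ->].
    have [Z [CZ s1 s2]] := circuit_elimination CY CX nYX eYX.
    by exists Z; rewrite CZ setUC s1 setUC s2.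
  apply: circuit_elimination => //.
  by move: eXY; rewrite !inE (negPf eA) !andbF /= => /andP[-> ->].
exists (sreorient A Z); rewrite mem_sreorient sreorientK; split=> //;
  apply/subsetP=> x; have := subsetP sZ1 x; have := subsetP sZ2 x;
  rewrite !inE /=; case: (x \in A);
  by rewrite ?(andbF, andbT, orbF, orbT) /= => h2 h1 h; auto.
Qed.

Definition reorientation : oriented_matroid E :=
  OrientedMatroid C_disjoint C_neq0 C_opp C_incomparable C_elimination.

Lemma circuits_reorientation :
  circuits reorientation = sreorient A @: circuits M.
Proof. by []. Qed.

Lemma independent_reorientation : independent reorientation =1 independent M.
Proof.
move=> S; apply/'forall_implyP/'forall_implyP=> h X CX.
  by rewrite -(supp_sreorient A); apply: h; rewrite mem_sreorient sreorientK.
by rewrite -(supp_sreorient A); apply: h; rewrite -mem_sreorient.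
Qed.

Lemma cocircuits_reorientation :
  cocircuits reorientation = sreorient A @: cocircuits M.
Proof.
have eB B : basis reorientation B = basis M B.
  exact: maxset_eq independent_reorientation.
have eD D : underlying_cocircuit reorientation D = underlying_cocircuit M D.
  by apply: minset_eq => D'; apply: eq_forallb => B; rewrite eB.
apply/setP=> Y; rewrite mem_sreorient !inE disjoint_sreorient supp_sreorient eD.
congr [&& _, _ & _]; apply/'forall_implyP/'forall_implyP=> h X CX.
  by rewrite -(sorthogonal_sreorient A) sreorientK; apply: h;
    rewrite mem_sreorient sreorientK.
by rewrite -(sorthogonal_sreorient A); apply: h; rewrite -mem_sreorient.
Qed.

End Reorientation.

(* The vertex v of the cube {-1,1}^n with coordinates v_i = (-1)^(v i): the    *)
(* boolean true stands for the coordinate -1 and false for 1.                  *)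
Notation cube n := {ffun 'I_n -> bool}.

Section Cube.
Variable n : nat.
Implicit Types (v : cube n) (I J : {set 'I_n}).

Definition cube_point (R : realType) v : 'rV[R]_n :=
  (\row_i (-1) ^+ (v i))%R.

Definition affinely_independent (R : realType) (S : {set cube n}) : Prop :=
  forall c : cube n -> R,
    (\sum_(v in S) c v = 0)%R ->
    (\sum_(v in S) c v *: cube_point R v = 0)%R ->
    forall v, v \in S -> c v = 0%R.

Definition cube_orientation (R : realType) (M : oriented_matroid (cube n)) :
    Prop :=
  forall S : {set cube n}, independent M S <-> affinely_independent R S.

Definition flip I v : cube n := [ffun i => (i \in I) (+) v i].

(* The facet on which the i-th coordinate equals (-1)^b.                       *)
Definition facet (b : bool) (i : 'I_n) : {set cube n} :=
  [set v : cube n | v i == b].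

Definition facet_family : {set signed_set (cube n)} :=
  [set X : signed_set (cube n) | [exists i, exists b,
     (X == (facet b i, set0)) || (X == (set0, facet b i))]].

Definition rectangle v I J : signed_set (cube n) :=
  ([set v; flip (I :|: J) v], [set flip I v; flip J v]).

Definition rectangle_family : {set signed_set (cube n)} :=
  [set X : signed_set (cube n) | [exists v, exists I, exists J,
     [&& I != set0, J != set0, [disjoint I & J]
       & (X == rectangle v I J) || (X == sopp (rectangle v I J))]]].

End Cube.

(* Main.v *)
Require Import Defs.
From mathcomp Require Import all_boot all_order all_algebra reals.
From mathcomp Require Import ring lra.

Set Implicit Arguments.
Unset Strict Implicit.
Unset Printing Implicit Defensive.

(** A rectangle meets each facet whose direction lies in [I] in an edge
    [{v, flip J v}], so its signs there determine, by orthogonality, whether the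
    signed cocircuit supported by that facet changes sign along the edge.  Let
    [g i] collect the signs of the cocircuits on the two facets of direction [i].
    Comparing a rectangle with directions [i, k] in [I] shows that [g i] and
    [g k] vary in the same way along [J] when [i, k] are not in [J]; comparing
    the two pairs of parallel edges of a rectangle with [J = {k}] shows that,
    after reorienting by [g k], each [g i] changes along the direction [k] by a
    sign which is the same at all vertices and for all [i <> k].  A further
    reorientation of one facet of direction [k] makes every [g i] constant on
    both facets.

    The signed cocircuit of a facet is obtained by contracting the complementary
    facet: the contraction has rank one, and circuits of the contraction are
    found inside the circuits of [M] with matching signs, which only needs weak
    elimination. *)

(** * Contraction of oriented matroids *)

Section Contraction.
Variable E : finType.
Implicit Types (M : oriented_matroid E) (S : {set E}) (X Y Z T : signed_set E).

Definition sdel S X : signed_set E := (X.1 :\: S, X.2 :\: S).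

Definition sconforms X Y := (X.1 \subset Y.1) && (X.2 \subset Y.2).

Lemma supp_sdel S X : supp (sdel S X) = supp X :\: S.
Proof. by rewrite /supp /= setDUl. Qed.

Lemma supp_sopp X : supp (sopp X) = supp X.
Proof. exact: setUC. Qed.

Lemma soppK : involutive (@sopp E).
Proof. by case. Qed.

Lemma supp_conforms X Y : sconforms X Y -> supp X \subset supp Y.
Proof. by case/andP=> *; apply: setUSS. Qed.

Lemma sconforms_trans : transitive sconforms.
Proof.
move=> Y X Z /andP[XY1 XY2] /andP[YZ1 YZ2].
by rewrite /sconforms (subset_trans XY1) // (subset_trans XY2).
Qed.

Lemma circuit_supp_neq0 M X : X \in circuits M -> supp X != set0.
Proof.
apply: contraTneq => /eqP; rewrite setU_eq0 => /andP[/eqP X1 /eqP X2].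
by rewrite [X]surjective_pairing X1 X2 circuit_neq0.
Qed.

Lemma circuit_supp_eq M X Y : X \in circuits M -> Y \in circuits M ->
  supp X \subset supp Y -> supp X = supp Y.
Proof.
by move=> CX CY /(circuit_incomparable CX CY)[->|->]; rewrite ?supp_sopp.
Qed.

(* Eliminating between [X] and [Y] an element on which they disagree keeps [h]
   and strictly decreases the set of disagreements. *)
Lemma conformal_circuit M X Y h : X \in circuits M -> Y \in circuits M ->
    h \in Y.1 -> h \notin supp X -> supp Y \subset h |: supp X ->
  exists Z, [/\ Z \in circuits M, h \in Z.1
              & sconforms (sdel [set h] Z) X].
Proof.
move=> CX; have dX := circuit_disjoint CX.
have [m] := ubnP #|(X.1 :&: Y.2) :|: (X.2 :&: Y.1)|.
elim: m Y => // m IHm Y; rewrite ltnS => leYm CY hY1 hX sYX.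
have hY : h \in supp Y by rewrite inE hY1.
have dY := circuit_disjoint CY.
(* With no disagreement left, [Y] itself conforms to [X] off [h]. *)
have [sep0|[e eXY]] := set_0Vmem ((X.1 :&: Y.2) :|: (X.2 :&: Y.1)).
  exists Y; split=> //; apply/andP; split; apply/subsetP=> x;
  move/setP: sep0 => /(_ x); move/subsetP: sYX => /(_ x); rewrite !inE /=;
  by case: (x == h); case: (x \in X.1); case: (x \in X.2);
     case: (x \in Y.1); case: (x \in Y.2) => //= /(_ isT).
have {}dX x : x \in X.1 -> x \notin X.2.
  by move=> xX; rewrite (disjointFr dX).
have eX : e \in supp X by move: eXY; rewrite !inE => /orP[]/andP[-> _] //; rewrite orbT.
have [Z [CZ sZ1 sZ2]] : exists Z, [/\ Z \in circuits M,
    Z.1 \subset (X.1 :|: Y.1) :\ e & Z.2 \subset (X.2 :|: Y.2) :\ e].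
  have nXY : X <> sopp Y by move=> eqXY; rewrite eqXY supp_sopp hY in hX.
  have nYX : Y <> sopp X by move=> eqXY; rewrite eqXY supp_sopp (negPf hX) in hY.
  case/setUP: eXY => [|eXY]; first exact: circuit_elimination.
  rewrite setIC in eXY.
  have [Z] := circuit_elimination CY CX nYX eXY.
  by rewrite (setUC Y.1) (setUC Y.2); exists Z.
have sZX : supp Z \subset (h |: supp X) :\ e.
  apply/subsetP=> x; move/subsetP: sZ1 => /(_ x); move/subsetP: sZ2 => /(_ x).
  move/subsetP: sYX => /(_ x); rewrite !inE.
  case: (x == e) => /= sYX sZ2 sZ1 => [/orP[/sZ1|/sZ2]|] //.
  by case/orP=> [/sZ1|/sZ2]/orP[->|xY]; rewrite ?orbT ?sYX ?xY ?orbT.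
(* Without [h], [Z] would be a circuit inside [supp X] that misses [e]. *)
have hZ : h \in supp Z.
  apply: contraT => hZ.
  have sZX' : supp Z \subset supp X.
    apply/subsetP=> x xZ; have /setD1P[_ /setU1P[xh|//]] := subsetP sZX x xZ.
    by rewrite -xh xZ in hZ.
  by have := subsetP sZX e; rewrite (circuit_supp_eq CZ CX) // eX !inE eqxx => /(_ isT).
have hZ1 : h \in Z.1.
  case/setUP: hZ => // /(subsetP sZ2)/setD1P[_ /setUP[hX2|]].
    by rewrite inE hX2 orbT in hX.
  by rewrite (disjointFr dY hY1).
apply: (IHm Z) => //; last exact: subset_trans sZX (subsetDl _ _).
(* A disagreement of [X] with [Z] is inherited from [Y], and [e] is no longer one. *)
apply: leq_trans leYm; apply: proper_card; apply/properP; split.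
  apply/subsetP=> x; move/subsetP: sZ1 => /(_ x); move/subsetP: sZ2 => /(_ x).
  rewrite !inE => sZ2 sZ1 /orP[]/andP[xX xZ].
    by have := sZ2 xZ; rewrite (negPf (dX _ xX)) xX /= => /andP[_ ->].
  have := sZ1 xZ; have [/dX|_] := boolP (x \in X.1); first by rewrite xX.
  by rewrite xX => /andP[_ ->].
exists e => //; apply: contraTN isT => eXZ.
have : e \in supp Z by move: eXZ; rewrite !inE => /orP[]/andP[_ ->]; rewrite ?orbT.
by move/(subsetP sZX); rewrite !inE eqxx.
Qed.

(* Two conformal circuits with opposite signs at [h] cannot both miss [e]:
   eliminating [h] would give a circuit strictly inside [X]. *)
Lemma conformal_circuit_through M X Y h e :
    X \in circuits M -> Y \in circuits M ->
    h \in supp Y -> h \notin supp X -> supp Y \subset h |: supp X ->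
    ~~ (supp Y \subset [set h]) -> e \in supp X ->
  exists Z, [/\ Z \in circuits M, h \in supp Z, e \in supp Z
              & sconforms (sdel [set h] Z) X].
Proof.
move=> CX CY hY hX sYX nY eX.
wlog hY1 : Y CY hY sYX nY / h \in Y.1.
  move=> IH; have /setUP[hY1|hY2] := hY; first exact: (IH Y).
  by apply: (IH (sopp Y)); rewrite ?supp_sopp // circuit_opp.
have [Z [CZ hZ cZX]] := conformal_circuit CX CY hY1 hX sYX.
have [Z' [CZ' hZ' cZX']] : exists Z, [/\ Z \in circuits M, h \in Z.1
    & sconforms (sdel [set h] Z) (sopp X)].
  apply: (@conformal_circuit _ _ Y); rewrite ?supp_sopp //; exact: circuit_opp.
have [eZ|eZ] := boolP (e \in supp Z).
  by exists Z; rewrite inE hZ.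
have [eZ'|eZ'] := boolP (e \in supp Z').
  exists (sopp Z'); split; rewrite ?supp_sopp //; first exact: circuit_opp.
    by rewrite inE hZ'.
  by case/andP: cZX' => c1 c2; apply/andP.
have hZZ' : h \in Z.1 :&: (sopp Z').2 by rewrite inE hZ.
(* If [Z = Z'], it would conform off [h] to both [X] and [sopp X], hence be a loop at [h]; lying
   inside [supp Y], it would force [supp Y] to be [[set h]]. *)
have nZZ' : Z <> sopp (sopp Z').
  rewrite soppK => eZZ'; rewrite -eZZ' in cZX'.
  have sZh : supp Z \subset [set h].
    apply/subsetP=> x xZ; rewrite in_set1; apply: contraT => nxh.
    case/andP: cZX cZX' => /subsetP/(_ x) + /subsetP/(_ x) +
      /andP[/subsetP/(_ x) + /subsetP/(_ x)].
    rewrite /= !in_setD1 nxh /= => c1 c2 c3 c4.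
    have dX := circuit_disjoint CX; case/setUP: xZ => xZ.
      by rewrite (disjointFr dX (c1 xZ)) in c3; exact: c3.
    by rewrite (disjointFl dX (c2 xZ)) in c4; exact: c4.
  by case/negP: nY; rewrite -(circuit_supp_eq CZ CY) // (subset_trans sZh) ?sub1set.
have [W [CW sW1 sW2]] := circuit_elimination CZ (circuit_opp CZ') nZZ' hZZ'.
(* Off [h], both [Z] and [Z'] lie in [supp X], and both miss [e]. *)
have sWX : supp W \subset supp X :\ e.
  rewrite !inE !negb_or in eZ eZ'; case/andP: eZ eZ' => eZ1 eZ2 /andP[eZ'1 eZ'2].
  have avoid (A B V : {set E}) : e \notin A -> e \notin B -> A :\ h \subset V ->
      B :\ h \subset V -> (A :|: B) :\ h \subset V :\ e.
    move=> eA eB sA sB; rewrite subsetD1 setDUl subUset sA sB /=.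
    by rewrite in_setU !in_setD1 (negPf eA) (negPf eB) !andbF.
  case/andP: cZX => c1 c2; case/andP: cZX' => c3 c4.
  rewrite /supp setDUl; apply: setUSS.
    exact: subset_trans sW1 (avoid _ _ _ eZ1 eZ'2 c1 c4).
  exact: subset_trans sW2 (avoid _ _ _ eZ2 eZ'1 c2 c3).
have sWX' := subset_trans sWX (subsetDl _ _).
have := subsetP sWX e; rewrite (circuit_supp_eq CW CX sWX') eX !inE eqxx.
by move=> /(_ isT).
Qed.

(* The contracted element stays in the ground set, as a coloop. *)
Lemma contraction1 M h : exists M',
  (forall T, T \in circuits M' ->
     exists2 X, X \in circuits M & T = sdel [set h] X) /\
  (forall X e, X \in circuits M -> e \in supp X -> e != h ->
     exists T, [/\ T \in circuits M', e \in supp T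
                 & sconforms T (sdel [set h] X)]).
Proof.
(* The circuits of the contraction are the nonempty traces off [h] of minimal support, with
   inherited signs. *)
pose traces := [set T in sdel [set h] @: circuits M | supp T != set0].
pose C := [set T in traces | [forall U in traces,
  (supp U \subset supp T) ==> (supp T \subset supp U)]].
have tracesP T : reflect (exists X, [/\ X \in circuits M,
    ~~ (supp X \subset [set h]) & T = sdel [set h] X]) (T \in traces).
  rewrite inE; apply: (iffP andP) => [[/imsetP[X CX ->]]|[X [CX nX ->]]].
    by rewrite supp_sdel setD_eq0; exists X.
  by rewrite supp_sdel setD_eq0; split=> //; apply: imset_f.
have C_opp_traces T : T \in traces -> sopp T \in traces.
  case/tracesP=> X [CX nX ->]; apply/tracesP; exists (sopp X).
  by rewrite circuit_opp // supp_sopp.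
(* Induction on the size of the trace: if it is not minimal, some circuit through [e] has a smaller
   trace conforming to [X]. *)
have conformal X e : X \in circuits M -> e \in supp X -> e != h ->
    exists T, [/\ T \in C, e \in supp T & sconforms T (sdel [set h] X)].
  have [m] := ubnP #|supp (sdel [set h] X)|.
  elim: m X => // m IHm X; rewrite ltnS => leXm CX eX neh.
  have nX : ~~ (supp X \subset [set h]).
    by apply/subsetPn; exists e; rewrite // in_set1.
  have tX : sdel [set h] X \in traces by apply/tracesP; exists X.
  have [CX'|] := boolP (sdel [set h] X \in C).
    by exists (sdel [set h] X); rewrite // /sconforms !subxx supp_sdel in_setD1 neh.
  rewrite inE tX /= => /forall_inPn[U /tracesP[Y [CY nY ->]]].
  rewrite negb_imply !supp_sdel => /andP[sYX nXY].
  (* If [h] were in [X], the circuit [Y] with the smaller trace would lie inside [X]; so [h] is in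
     [Y] but not in [X]. *)
  have [hX|hX] := boolP (h \in supp X).
    have sYX' : supp Y \subset supp X.
      apply/subsetP=> x xY; have [->//|nxh] := eqVneq x h.
      by have := subsetP sYX x; rewrite !in_setD1 nxh xY => /(_ isT).
    by rewrite (circuit_supp_eq CY CX) // subxx in nXY.
  have sYX' : supp Y \subset h |: supp X.
    apply/subsetP=> x xY; rewrite in_setU1; have [//|nxh] := eqVneq x h.
    by have := subsetP sYX x; rewrite !in_setD1 nxh xY => /(_ isT).
  have hY : h \in supp Y.
    apply: contraT => hY.
    have sYX2 : supp Y \subset supp X.
      apply/subsetP=> x xY; have /setU1P[xh|//] := subsetP sYX' x xY.
      by rewrite -xh xY in hY.
    by rewrite (circuit_supp_eq CY CX) // subxx in nXY.
  have [Z [CZ hZ eZ cZX]] := conformal_circuit_through CX CY hY hX sYX' nY eX.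
  have sZX := supp_conforms cZX.
  have dXh : sdel [set h] X = X.
    case: X hX {leXm CX nX eX tX sYX nXY sYX' cZX sZX} => X1 X2.
    rewrite /supp /sdel /= => hX; congr pair; apply: setDidPl;
    by rewrite disjoint_sym disjoints1; apply: contra hX; rewrite inE => ->; rewrite ?orbT.
  (* A trace of [Z] as large as [supp X] would put [supp X] inside [supp Z], making the two equal
     although only [Z] contains [h]. *)
  have lt : #|supp (sdel [set h] Z)| < m.
    apply: leq_trans leXm; rewrite ltnNge -?subset_leqif_cards // dXh.
    apply: contra hX => leXZ.
    have eXZ : supp (sdel [set h] Z) = supp X by apply/eqP; rewrite eqEcard sZX.
    rewrite (circuit_supp_eq CX CZ) // -eXZ supp_sdel; exact: subsetDl.
  have [T [CT eT cTZ]] := IHm Z lt CZ eZ neh; exists T; split=> //.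
  by rewrite dXh; apply: sconforms_trans cZX.
have C_tr T : T \in C -> T \in traces by rewrite inE => /andP[].
have C_disjoint T : T \in C -> [disjoint T.1 & T.2].
  case/C_tr/tracesP=> X [CX _ ->] /=.
  apply: disjointWl (subsetDl _ _) _; apply: disjointWr (subsetDl _ _) _.
  exact: circuit_disjoint CX.
have C_neq0 : (set0, set0) \notin C.
  by apply/negP=> /C_tr; rewrite inE /supp setU0 eqxx andbF.
have C_opp T : T \in C -> sopp T \in C.
  case/setIdP=> tT /forall_inP minT; apply/setIdP.
  split; first exact: C_opp_traces.
  by apply/forall_inP=> U tU; rewrite supp_sopp minT.
have C_incomparable T U : T \in C -> U \in C -> supp T \subset supp U ->
    T = U \/ T = sopp U.
  case/setIdP=> /tracesP[X [CX nX ->]] _.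
  case/setIdP=> /tracesP[Y [CY nY ->]] /forall_inP minY sXY.
  have tX : sdel [set h] X \in traces by apply/tracesP; exists X.
  have := minY _ tX; rewrite sXY /= => sYX.
  have eXY : supp X :\ h = supp Y :\ h.
    by apply/eqP; rewrite eqEsubset -!supp_sdel sXY sYX.
  suff [->|->] : X = Y \/ X = sopp Y by [left|right].
  (* The supports agree off [h], so in each case one contains the other. *)
  have [hX|hX] := boolP (h \in supp X); have [hY|hY] := boolP (h \in supp Y).
  - apply: (circuit_incomparable CX CY).
    by rewrite -(setD1K hX) -(setD1K hY) eXY.
  - suff: sopp Y = X \/ sopp Y = sopp X.
      by case=> [<-|e]; [right|left; rewrite -[X]soppK -e soppK].
    apply: (circuit_incomparable (circuit_opp CY) CX).
    rewrite supp_sopp; apply/subsetP=> x xY; have : x \in supp X :\ h.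
      by rewrite eXY in_setD1 xY andbT; apply: contraNneq hY => <-.
    by rewrite in_setD1 => /andP[].
  - apply: (circuit_incomparable CX CY); apply/subsetP=> x xX.
    have : x \in supp Y :\ h.
      by rewrite -eXY in_setD1 xX andbT; apply: contraNneq hX => <-.
    by rewrite in_setD1 => /andP[].
  - apply: (circuit_incomparable CX CY); apply/subsetP=> x xX.
    have : x \in supp Y :\ h.
      by rewrite -eXY in_setD1 xX andbT; apply: contraNneq hX => <-.
    by rewrite in_setD1 => /andP[].
have C_elimination T U e : T \in C -> U \in C -> T <> sopp U ->
    e \in T.1 :&: U.2 ->
    exists Z, [/\ Z \in C, Z.1 \subset (T.1 :|: U.1) :\ e
                         & Z.2 \subset (T.2 :|: U.2) :\ e].
  case/C_tr/tracesP=> X [CX nX ->] /C_tr/tracesP[Y [CY nY ->]] nXY.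
  rewrite !inE /= => /andP[/andP[neh eX] /andP[_ eY]].
  have nXY' : X <> sopp Y by move=> eqXY; apply: nXY; rewrite eqXY.
  have eXY : e \in X.1 :&: Y.2 by rewrite inE eX.
  have [Z [CZ sZ1 sZ2]] := circuit_elimination CX CY nXY' eXY.
  (* If [Z] were a loop at [h], it would lie inside [X] or [Y], whose trace would then be empty. *)
  have nZ : ~~ (supp Z \subset [set h]).
    apply/negP=> sZh.
    have /setUP hXY : h \in supp X :|: supp Y.
      have [Z0|[x xZ]] := set_0Vmem (supp Z).
        by have := circuit_supp_neq0 CZ; rewrite Z0 eqxx.
      have /set1P xh := subsetP sZh _ xZ.
      move: xZ; rewrite xh inE => /orP[/(subsetP sZ1)|/(subsetP sZ2)];
      rewrite !inE => /andP[_ /orP[]->]; by rewrite ?orbT.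
    case: hXY => [hX|hY].
      by move: nX; rewrite -(circuit_supp_eq CZ CX) ?sZh // (subset_trans sZh) ?sub1set.
    by move: nY; rewrite -(circuit_supp_eq CZ CY) ?sZh // (subset_trans sZh) ?sub1set.
  case/subsetPn: nZ => x xZ; rewrite in_set1 => nxh.
  (* The trace of [Z] may fail to be minimal; a minimal one conforming to it satisfies the same
     inclusions. *)
  have [V [CV _ /andP[sV1 sV2]]] := conformal _ _ CZ xZ nxh.
  exists V; split=> //.
    apply: subset_trans sV1 _; rewrite -setDUl !setDDl [_ :|: [set e]]setUC -setDDl.
    exact: setSD.
  apply: subset_trans sV2 _; rewrite -setDUl !setDDl [_ :|: [set e]]setUC -setDDl.
  exact: setSD.
exists (OrientedMatroid C_disjoint C_neq0 C_opp C_incomparable C_elimination).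
split=> // T /C_tr/tracesP[X [CX _ ->]]; by exists X.
Qed.

(** The elements of [S] are contracted one at a time; restrictions compose and conformity is
    transitive. *)
Lemma contraction M S : exists M',
  (forall T, T \in circuits M' ->
     exists2 X, X \in circuits M & T = sdel S X) /\
  (forall X e, X \in circuits M -> e \in supp X -> e \notin S ->
     exists T, [/\ T \in circuits M', e \in supp T
                 & sconforms T (sdel S X)]).
Proof.
have [m] := ubnP #|S|; elim: m S => // m IHm S; rewrite ltnS => leSm.
have [->|[h hS]] := set_0Vmem S.
  exists M; have d0 X : sdel set0 X = X.
    by rewrite /sdel !setD0 -surjective_pairing.
  by split=> [X CX|X e CX eX _]; exists X; rewrite ?d0 // /sconforms !subxx.
have [|M1 [M1C M1conf]] := IHm (S :\ h); first by rewrite (cardsD1 h) hS in leSm.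
have [M2 [M2C M2conf]] := contraction1 M1 h.
have sdelD1 X : sdel [set h] (sdel (S :\ h) X) = sdel S X.
  by rewrite /sdel /= !setDDl setUC setD1K.
exists M2; split=> [T /M2C[U /M1C[X CX ->] ->]|X e CX eX eS].
  by exists X; rewrite ?sdelD1.
have neh : e != h by apply: contraNneq eS => ->.
have eSh : e \notin S :\ h by rewrite in_setD1 negb_and eS orbT.
have [U [CU eU /andP[c1 c2]]] := M1conf X e CX eX eSh.
have [T [CT eT cTU]] := M2conf U e CU eU neh.
exists T; split=> //; apply: sconforms_trans cTU _.
by rewrite -sdelD1; apply/andP; split; apply: setSD.
Qed.
End Contraction.

(** * Signatures of cocircuits through rank-one contractions *)

Section RankOne.
Variable E : finType.
Implicit Types (M : oriented_matroid E) (D : {set E}) (X T : signed_set E).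

(** Descent: eliminating an element [w] other than [v0] from a positive circuit by means of
    [([set v0], [set w])] gives a positive circuit with fewer elements besides [v0]. *)
Lemma no_positive_circuit M D v0 :
    {in circuits M, forall T, supp T \subset D} ->
    {in circuits M, forall T, supp T != [set v0]} ->
    {in D, forall w, w != v0 -> ([set v0], [set w]) \in circuits M} ->
  {in circuits M, forall T, T.2 != set0}.
Proof.
move=> sD n1 star T; have [m] := ubnP #|T.1 :\ v0|.
elim: m T => // m IHm T; rewrite ltnS => leTm CT; apply: contraT.
rewrite negbK => /eqP T2; have sT : supp T = T.1 by rewrite /supp T2 setU0.
have [w wT nw0] : exists2 w, w \in T.1 & w != v0.
  have [T1|[w wT]] := set_0Vmem (T.1 :\ v0); last first.
    by exists w; case/setD1P: wT.
  have := circuit_supp_neq0 CT; have := n1 T CT; rewrite sT.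
  move/eqP: T1; rewrite setD_eq0 subset1 => /orP[/eqP->|/eqP->];
  by rewrite eqxx.
have wD : w \in D by rewrite (subsetP (sD T CT)) // sT.
have nT : T <> sopp ([set v0], [set w]).
  by move=> eT; move/setP/(_ v0): T2; rewrite eT /= !inE eqxx.
have wTw : w \in T.1 :&: [set w] by rewrite !inE wT eqxx.
have [Z [CZ sZ1 sZ2]] := circuit_elimination CT (star w wD nw0) nT wTw.
have Z2 : Z.2 = set0.
  by apply/eqP; rewrite -subset0 (subset_trans sZ2) // T2 /= set0U setDv.
suff: Z.2 != set0 by rewrite Z2 eqxx.
apply: IHm => //; apply: leq_trans leTm; apply/proper_card/properP; split.
  apply: subset_trans (setSD _ sZ1) _; apply/subsetP=> x; rewrite !inE /=.
  by case: (x == v0); case: (x \in T.1); rewrite ?orbT ?andbF.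
exists w; first by rewrite in_setD1 nw0.
by apply/negP=> /setD1P[_ /(subsetP sZ1)]; rewrite !inE eqxx.
Qed.

(** After contraction of the complement of [D], every element of [D] is parallel to a base point
    [v0]. A reorientation makes all these two-element circuits opposite in sign; then every circuit
    has both signs, that is, is orthogonal to [(D, set0)]. Conformity carries this back to the
    circuits of [M]. *)
Lemma orthogonal_signature M D :
    {in D &, forall v w, v != w ->
       exists2 X, X \in circuits M & supp X :&: D = [set v; w]} ->
    {in circuits M, forall X v, supp X :&: D <> [set v]} ->
  exists P, {in circuits M, forall X, sorthogonal X (D :&: P, D :\: P)}.
Proof.
move=> pairs n1; have [->|[v0 v0D]] := set_0Vmem D.
  by exists set0 => X _; rewrite /sorthogonal /= !(set0I, set0D, setI0).
have [M' [M'C M'conf]] := contraction M (~: D).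
have M'D : {in circuits M', forall T, supp T \subset D}.
  by move=> T /M'C[X _ ->]; rewrite supp_sdel setDE setCK subsetIr.
have M'n1 : {in circuits M', forall T, supp T != [set v0]}.
  by move=> T /M'C[X CX ->]; rewrite supp_sdel setDE setCK; apply/eqP/n1.
(* Orthogonality to [([set v0], [set w])] forces equal signs at [v0] and [w], so [P] is the part of
   the cocircuit with the sign of [v0]. *)
pose P := [set w | (w == v0) || (([set v0], [set w]) \in circuits M')].
have PE w : w != v0 -> (w \in P) = (([set v0], [set w]) \in circuits M').
  by rewrite inE => /negPf->.
have v0P : v0 \in P by rewrite inE eqxx.
exists P; clearbody P.
have star : {in D, forall w, w != v0 ->
    ([set v0], [set w]) \in circuits (reorientation (~: P) M')}.
  move=> w wD nw0; rewrite mem_sreorient.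
  have -> : sreorient (~: P) ([set v0], [set w]) =
      if w \in P then ([set v0], [set w]) else ([set v0; w], set0).
    case wP: (w \in P); congr pair; apply/setP=> x;
    rewrite in_setU in_setD in_setI in_setC negbK !inE;
    by have [->|nx0] := eqVneq x v0; last have [->|nxw] := eqVneq x w;
       rewrite ?v0P ?wP ?(eq_sym v0 w) ?(negPf nw0) ?andbF ?andbT.
  have [wP|wP] := ifPn; first by rewrite -PE.
  have [X CX eX] : exists2 X, X \in circuits M & supp X :&: D = [set v0; w].
    by apply: pairs; rewrite // eq_sym.
  have v0X : v0 \in supp X by have := set21 v0 w; rewrite -eX => /setIP[].
  have [T [CT v0T cTX]] : exists T, [/\ T \in circuits M', v0 \in supp T
      & sconforms T (sdel (~: D) X)].
    by apply: M'conf CX v0X _; rewrite inE negbK.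
  have {X CX eX v0X cTX} sT : supp T \subset [set v0; w].
    by rewrite (subset_trans (supp_conforms cTX)) // supp_sdel setDE setCK eX.
  (* No circuit of the contraction is supported on [v0] alone. *)
  have wT : w \in supp T.
    apply: contraT => wT; have := M'n1 T CT; rewrite eqEsubset sub1set v0T andbT.
    case/subsetPn=> x xT; rewrite in_set1 => nx0.
    have /set2P[x0|xw] := subsetP sT x xT; first by rewrite x0 eqxx in nx0.
    by rewrite -xw xT in wT.
  wlog v0T1 : T CT v0T sT wT / v0 \in T.1.
    move=> IH; have /setUP[v0T1|v0T2] := v0T; first exact: (IH T).
    by apply: (IH (sopp T)); rewrite ?supp_sopp // circuit_opp.
  have dT := circuit_disjoint CT.
  have v0T2 := disjointFr dT v0T1.
  have xT x : x != v0 -> x != w -> (x \in T.1 = false) * (x \in T.2 = false).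
    move=> nx0 nxw; have := contra (subsetP sT x).
    by rewrite !inE !negb_or nx0 nxw => /(_ isT)/andP[/negPf-> /negPf->].
  (* Equal signs at [v0] and [w] are what is wanted when [w] is outside [P]; opposite signs would
     put [w] in [P]. *)
  case/setUP: wT => [wT1|wT2].
    congr (_ \in circuits M'): CT; rewrite [T]surjective_pairing.
    congr pair; apply/setP=> x; rewrite !inE.
      by have [->|nx0] := eqVneq x v0; last have [->|nxw] := eqVneq x w;
         rewrite ?v0T1 ?wT1 ?xT.
    by have [->|nx0] := eqVneq x v0; last have [->|nxw] := eqVneq x w;
       rewrite ?v0T2 ?(disjointFr dT wT1) ?xT.
  case/negP: wP; rewrite PE //.
  congr (_ \in circuits M'): CT; rewrite [T]surjective_pairing.
  congr pair; apply/setP=> x; rewrite !inE.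
    by have [->|nx0] := eqVneq x v0; last have [->|nxw] := eqVneq x w;
       rewrite ?v0T1 ?(disjointFl dT wT2) ?xT.
  by have [->|nx0] := eqVneq x v0; last have [->|nxw] := eqVneq x w;
     rewrite ?v0T2 ?wT2 ?xT // eq_sym (negPf nw0).
have pos : {in circuits M', forall T, (sreorient (~: P) T).2 != set0}.
  move=> T CT; apply: (no_positive_circuit _ _ star); last first.
  - by rewrite mem_sreorient sreorientK.
  - by move=> U; rewrite mem_sreorient -(supp_sreorient (~: P)) => /M'n1.
  - by move=> U; rewrite mem_sreorient -(supp_sreorient (~: P)) => /M'D.
move=> X CX; rewrite -(sorthogonal_sreorient (~: P)).
have -> : sreorient (~: P) (D :&: P, D :\: P) = (D, set0).
  by congr pair; apply/setP=> x; rewrite !inE; case: (x \in P);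
     rewrite ?andbF ?andbT ?orbF.
rewrite /sorthogonal /= !setI0 setU0 set0U.
have [XD0|[e /setIP[eX eD]]] := set_0Vmem (supp X :&: D).
  have XD x : x \in supp X -> x \in D -> False.
    by move=> xX xD; move/setP/(_ x): XD0; rewrite in_setI xX xD inE.
  have e0 (A : {set E}) : A \subset supp X -> A :&: D = set0.
    by move=> sA; apply/setP=> x; rewrite !inE; apply/andP=> -[/(subsetP sA)/XD].
  rewrite !e0 //; rewrite -(supp_sreorient (~: P)); [exact: subsetUr|exact: subsetUl].
have [T [CT _ /andP[c1 c2]]] : exists T, [/\ T \in circuits M', e \in supp T
    & sconforms T (sdel (~: D) X)] by apply: M'conf CX eX _; rewrite inE negbK.
have c : sconforms (sreorient (~: P) T) (sdel (~: D) (sreorient (~: P) X)).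
  move: c1 c2 => /= /subsetP c1 /subsetP c2.
  apply/andP; split; apply/subsetP=> x; have := c1 x; have := c2 x; rewrite !inE;
  by case: (x \in P); case: (x \in D); rewrite ?(andbT, andbF, orbF).
case/andP: c; rewrite /= !setDE !setCK => c1' c2'.
have nz (A B : {set E}) : A \subset B -> A != set0 -> B != set0.
  by move=> sAB; apply: contraNneq => B0; rewrite -subset0 -B0.
(* Applied to [T] and to its opposite, [pos] makes both signs of the reoriented [T] nonempty, hence
   those of [X] on [D]. *)
have p1 := pos _ CT; have p2 := pos _ (circuit_opp CT).
rewrite /= !setDE !setCK in p1 p2.
by rewrite (nz _ _ c2' p1) (nz _ _ c1' p2).
Qed.
End RankOne.

(** * Consequences of orthogonality *)

(** Agreement must occur at one of the two common elements and disagreement at the other, so exactly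
    one of [X] and [Y] changes sign between them. *)
Lemma sorthogonal_two (E : finType) (X Y : signed_set E) x y :
    [disjoint X.1 & X.2] -> [disjoint Y.1 & Y.2] ->
    supp X :&: supp Y = [set x; y] -> sorthogonal X Y ->
  (x \in X.1) (+) (y \in X.1) = ~~ ((x \in Y.1) (+) (y \in Y.1)).
Proof.
move=> dX dY eXY.
have opp (Z : signed_set E) t : [disjoint Z.1 & Z.2] -> t \in supp Z ->
    (t \in Z.2) = (t \notin Z.1).
  move=> dZ; rewrite inE; have [tZ|_] //= := boolP (t \in Z.1).
  by rewrite (disjointFr dZ tZ).
pose s t := (t \in X.1) == (t \in Y.1).
have agree : ((X.1 :&: Y.1) :|: (X.2 :&: Y.2) != set0) = s x || s y.
  have in_agree t : t \in [set x; y] ->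
      (t \in (X.1 :&: Y.1) :|: (X.2 :&: Y.2)) = s t.
    rewrite -eXY => /setIP[tX tY]; rewrite !inE (opp X) // (opp Y) // /s.
    by case: (t \in X.1); case: (t \in Y.1).
  apply/set0Pn/orP=> [[t tA]|]; last first.
    by case=> st; [exists x|exists y]; rewrite in_agree ?set21 ?set22.
  have tXY : t \in [set x; y].
    by rewrite -eXY; move: tA; rewrite !inE => /orP[]/andP[-> ->]; rewrite ?orbT.
  by rewrite in_agree // in tA; case/set2P: tXY tA => ->; [left|right].
have disagree : ((X.1 :&: Y.2) :|: (X.2 :&: Y.1) != set0) = ~~ s x || ~~ s y.
  have in_agree t : t \in [set x; y] ->
      (t \in (X.1 :&: Y.2) :|: (X.2 :&: Y.1)) = ~~ s t.
    rewrite -eXY => /setIP[tX tY]; rewrite !inE (opp X) // (opp Y) // /s.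
    by case: (t \in X.1); case: (t \in Y.1).
  apply/set0Pn/orP=> [[t tA]|]; last first.
    by case=> st; [exists x|exists y]; rewrite in_agree ?set21 ?set22.
  have tXY : t \in [set x; y].
    by rewrite -eXY; move: tA; rewrite !inE => /orP[]/andP[-> ->]; rewrite ?orbT.
  by rewrite in_agree // in tA; case/set2P: tXY tA => ->; [left|right].
rewrite /sorthogonal agree disagree /s.
by case: (x \in X.1); case: (y \in X.1); case: (x \in Y.1); case: (y \in Y.1).
Qed.

Lemma cocircuit_opp (E : finType) (N : oriented_matroid E) Y :
  Y \in cocircuits N -> sopp Y \in cocircuits N.
Proof.
rewrite !inE /= supp_sopp disjoint_sym => /and3P[-> -> /forall_inP orth] /=.
apply/forall_inP=> X /orth; rewrite /sorthogonal /= => /eqP eXY.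
by rewrite eq_sym; apply/eqP.
Qed.

(** * Affine dependence and rectangles in the cube *)

Section CubeMatroid.
Import GRing.Theory Num.Theory.
Local Open Scope ring_scope.
Variables (R : realType) (n : nat).
Implicit Types (v w x : cube n) (I J : {set 'I_n}) (S : {set cube n}).

(** Coordinate [i] of the weighted sum is the difference of the weights of the two facets of
    direction [i], whose sum is the total weight; as 2 is invertible, each facet has weight zero. *)
Lemma affinely_independentP S :
  affinely_independent R S <->
  (forall c : cube n -> R, \sum_(v in S) c v = 0 ->
     (forall i b, \sum_(v in S | v i == b) c v = 0) ->
   {in S, forall v, c v = 0}).
Proof.
have coordE (c : cube n -> R) i :
    (\sum_(v in S) c v *: cube_point R v) 0 i =
    \sum_(v in S) c v * (-1) ^+ v i.
  by rewrite summxE; apply: eq_bigr => v _; rewrite !mxE.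
split=> indS c c0 ci; [apply: (indS c c0)|apply: (indS c c0) => i b].
  apply/rowP=> i; rewrite coordE mxE (bigID (fun v => v i == true)) /=.
  under eq_bigr => x /andP[_ /eqP->] do rewrite mulrN1.
  rewrite sumrN ci oppr0 add0r -[RHS](ci i false).
  apply: eq_big => [x|x /andP[_ /negPf]]; first by case: (x i).
  by case: (x i) => // _; rewrite mulr1.
have /rowP/(_ i) := ci; rewrite coordE mxE => ci0.
suff: 2 * \sum_(v in S | v i == b) c v = 0.
  by move/eqP; rewrite mulf_eq0 pnatr_eq0 => /eqP.
rewrite big_mkcondr mulr_sumr /=.
(* Twice the indicator of [v i == b] is one plus the product of the signs of [b] and [v i]. *)
transitivity (\sum_(v in S) (c v + (-1) ^+ b * (c v * (-1) ^+ v i))).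
  apply: eq_bigr => x _; case: (x i); case: b => /=; rewrite ?expr0 ?expr1; ring.
by rewrite big_split /= -mulr_sumr c0 ci0 mulr0 addr0.
Qed.

Lemma flip0 v : flip set0 v = v.
Proof. by apply/ffunP=> i; rewrite ffunE inE. Qed.

Lemma flip_flip I J v : [disjoint I & J] -> flip I (flip J v) = flip (I :|: J) v.
Proof.
move=> dIJ; apply/ffunP=> i; rewrite !ffunE inE.
by have [iI|] := boolP (i \in I); rewrite // (disjointFr dIJ iI).
Qed.

Lemma flipK I : involutive (@flip n I).
Proof. by move=> v; apply/ffunP=> i; rewrite !ffunE addbA addbb. Qed.

Lemma flip_out I v i : i \notin I -> flip I v i = v i.
Proof. by rewrite ffunE => /negPf->. Qed.

Lemma flip_in I v i : i \in I -> flip I v i = ~~ v i.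
Proof. by rewrite ffunE => ->. Qed.

Lemma flip_diff v w : flip [set i | v i != w i] v = w.
Proof. by apply/ffunP=> i; rewrite ffunE inE; case: (v i); case: (w i). Qed.

Lemma cube_neq k v w : v k != w k -> (v == w) = false.
Proof. by apply: contraNF => /eqP->. Qed.

(** The four vertices are distinct: any two differ at [i] or at [j]. *)
Lemma sum_rectangle (V : nmodType) v I J (F : cube n -> V) :
    I != set0 -> J != set0 -> [disjoint I & J] ->
  \sum_(x in supp (rectangle v I J)) F x =
  F v + F (flip (I :|: J) v) + (F (flip I v) + F (flip J v)).
Proof.
case/set0Pn=> i iI /set0Pn[j jJ] dIJ.
have iJ : i \notin J by rewrite (disjointFr dIJ).
have jI : j \notin I by rewrite (disjointFl dIJ).
have flipE := (ffunE, @in_setU, iI, jJ, negPf iJ, negPf jI, orbT).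
have dd : [disjoint [set v; flip (I :|: J) v] & [set flip I v; flip J v]].
  rewrite -setI_eq0; apply/eqP/setP=> x; rewrite !inE; apply/negbTE/negP.
  case/andP=> /orP[]/eqP-> /orP[]; apply/negP/negbT.
  - by apply: (cube_neq (k := i)); rewrite !flipE; case: (v i) => /=.
  - by apply: (cube_neq (k := j)); rewrite !flipE; case: (v j) => /=.
  - by apply: (cube_neq (k := j)); rewrite !flipE; case: (v j) => /=.
  - by apply: (cube_neq (k := i)); rewrite !flipE; case: (v i) => /=.
transitivity (\sum_(x in
    [predU [set v; flip (I :|: J) v] & [set flip I v; flip J v]]) F x).
  by apply: eq_bigl => x; rewrite !inE.
rewrite bigU //= !big_setU1 ?big_set1 // in_set1;
  by apply/negbT/(cube_neq (k := i)); rewrite !flipE; case: (v i) => /=.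
Qed.

Lemma supp_rectangle_facet v I J i : i \in I -> [disjoint I & J] ->
  supp (rectangle v I J) :&: facet (v i) i = [set v; flip J v].
Proof.
move=> iI dIJ; have iJ : i \notin J by rewrite (disjointFr dIJ).
apply/setP=> x; rewrite !inE.
have [xi|nxi] := eqVneq (x i) (v i).
  have ne (y : cube n) : y i = ~~ v i -> (x == y) = false.
    by move=> yi; rewrite (cube_neq (k := i)) // yi xi; case: (v i).
  rewrite (ne (flip (_ :|: J) v)) ?(ne (flip I v)) ?andbT ?orbF //;
  by rewrite flip_in ?inE ?iI.
have ne (y : cube n) : y i = v i -> (x == y) = false.
  by move=> yi; rewrite (cube_neq (k := i)) // yi.
by rewrite !(ne v, ne (flip J v)) ?andbF // flip_out.
Qed.

(** * Circuits and cocircuits of the cube matroid *)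

Variables (M : oriented_matroid (cube n)) (orientM : cube_orientation R M).

Lemma circuit_dependent X : X \in circuits M -> ~ affinely_independent R (supp X).
Proof.
by move=> CX /orientM/forall_inP/(_ X CX); rewrite subxx.
Qed.

(** In a dependence on [supp X], the facet equation would kill the coefficient of a vertex alone on
    the facet, leaving a dependence on the independent set [supp X :\ v]. *)
Lemma circuit_facet X b i v :
  X \in circuits M -> supp X :&: facet b i <> [set v].
Proof.
move=> CX Xv; have /setIP[vX] : v \in supp X :&: facet b i by rewrite Xv set11.
rewrite inE => /eqP vi.
have : independent M (supp X :\ v).
  apply/forall_inP=> Y CY; apply/negP=> sYX.
  have := subsetP sYX v; rewrite (circuit_supp_eq CY CX) ?vX ?setD11 => [/(_ isT)//|].
  exact: subset_trans sYX (subsetDl _ _).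
move/orientM/affinely_independentP=> ind; apply: (circuit_dependent CX).
apply/affinely_independentP=> c c0 ci.
have cv : c v = 0.
  rewrite -[RHS](ci i b) (big_pred1 v) // => x.
  by move/setP/(_ x): Xv; rewrite in_setI !inE.
have D1 (P : pred (cube n)) :
    \sum_(x in supp X :\ v | P x) c x = \sum_(x in supp X | P x) c x.
  rewrite [RHS]big_mkcondr [LHS]big_mkcondr /= [RHS](big_setD1 v) //= cv.
  by case: (P v); rewrite add0r.
have D1T : \sum_(x in supp X :\ v) c x = \sum_(x in supp X) c x.
  by rewrite [RHS](big_setD1 v) //= cv add0r.
move=> x xX; have [->//|nxv] := eqVneq x v; apply: (ind c) => [|j b'|].
- by rewrite D1T.
- by rewrite D1.
- by rewrite in_setD1 nxv.
Qed.

Lemma rectangle_circuit v I J :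
    I != set0 -> J != set0 -> [disjoint I & J] ->
  exists2 X, X \in circuits M & supp X = supp (rectangle v I J).
Proof.
move=> I0 J0 dIJ; have sumE := sum_rectangle v _ I0 J0 dIJ.
have [i iI] := set0Pn _ I0; have [j jJ] := set0Pn _ J0.
have iJ : i \notin J by rewrite (disjointFr dIJ).
have jI : j \notin I by rewrite (disjointFl dIJ).
have iU : i \in I :|: J by rewrite inE iI.
have jU : j \in I :|: J by rewrite inE jJ orbT.
set Q := supp _ in sumE *.
have : ~~ independent M Q.
  apply/negP=> /orientM/affinely_independentP ind.
  (* Alternating weights sum to zero on every facet. *)
  pose c x : R := if x \in (rectangle v I J).1 then 1 else -1.
  have cE : (c v = 1) * (c (flip (I :|: J) v) = 1) * (c (flip I v) = -1)
     * (c (flip J v) = -1).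
    have flipE := (ffunE, @in_setU, iI, jJ, negPf iJ, negPf jI, orbT).
    rewrite /c /= !in_set2 !eqxx orbT /=.
    split; first split=> //.
      rewrite (cube_neq (k := i)) ?(cube_neq (k := j)) // !flipE; by case: (v _).
    rewrite (cube_neq (k := j)) ?(cube_neq (k := i)) // !flipE; by case: (v _).
  have: c v = 0.
    apply: (ind c); last by rewrite /Q !inE eqxx.
      by rewrite sumE !cE; ring.
    move=> k b; rewrite big_mkcondr sumE !cE /= !ffunE inE.
    have [kI|kI] := boolP (k \in I); first rewrite (disjointFr dIJ kI).
      by case: (v k); case: b => /=; ring.
    by case: (k \in J); case: (v k); case: b => /=; ring.
  by rewrite cE => /eqP; rewrite oner_eq0.
case/forall_inPn=> X CX; rewrite negbK => sXQ; exists X => //.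
apply/eqP; rewrite eqEsubset sXQ; apply/subsetP=> y yQ; apply: contraT => yX.
case: (circuit_dependent CX); apply/affinely_independentP=> c c0 ci.
(* The dependence is extended by zero to the rectangle. The facet equations in directions [i] and
   [j] make adjacent weights opposite, so the zero at [y] spreads to all four vertices. *)
pose c' x := if x \in supp X then c x else 0.
have c'i k b : \sum_(x in Q) (if x k == b then c' x else 0) = 0.
  rewrite -[RHS](ci k b) -!big_mkcondr; apply: eq_bigl => x.
  by rewrite andbAC; have [/(subsetP sXQ)->//|] := boolP (x \in supp X); rewrite andbF.
have := c'i i (v i); have := c'i i (~~ v i).
have := c'i j (v j); have := c'i j (~~ v j).
rewrite !sumE !(flip_in _ iI, flip_in _ jJ, flip_in _ iU, flip_in _ jU).
have neqbN b : (b == ~~ b) = false by case: b.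
have neqNb b : (~~ b == b) = false by case: b.
rewrite !(flip_out _ iJ, flip_out _ jI) !(eqxx, neqbN, neqNb).
move=> e1 e2 e3 e4.
have yE : c' y = 0 by rewrite /c' (negPf yX).
have Q0 x : x \in Q -> c' x = 0.
  move: yQ yE; rewrite /Q !inE => yQ yE xQ.
  have av : c' v = 0.
    by case/orP: yQ => /orP[]/eqP yE'; rewrite yE' in yE; lra.
  by case/orP: xQ => /orP[]/eqP->; lra.
by move=> x xX; have := Q0 x (subsetP sXQ x xX); rewrite /c' xX.
Qed.

Definition star w : {set cube n} :=
  w |: [set flip [set j] w | j in 'I_n].

Lemma sum_star (V : nmodType) w (F : cube n -> V) :
  \sum_(x in star w) F x = F w + \sum_j F (flip [set j] w).
Proof.
have inj : injective (fun j => flip [set j] w).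
  move=> j k /ffunP/(_ j); rewrite !ffunE !inE eqxx.
  by case: eqVneq => //= _; case: (w j).
rewrite big_setU1 /=; first by rewrite big_imset //=; move=> *; apply: inj.
apply/imsetP=> -[j _ /ffunP/(_ j)]; rewrite ffunE set11.
by case: (w j).
Qed.

(** Each neighbour of [w] is alone in the star on a facet, which gives independence. Any other [u]
    is [w] plus the differences [flip [set j] w - w] over the coordinates where [u] and [w] differ,
    which gives maximality. *)
Lemma star_basis w : basis M (star w).
Proof.
apply/maxsetP; split=> [|B indB sB].
  apply/orientM/affinely_independentP=> c c0 ci.
  have cj j : c (flip [set j] w) = 0.
    have := ci j (~~ w j); rewrite big_mkcondr sum_star (bigD1 j) //= big1 => [|k nkj].
      by rewrite ffunE set11 eqxx; case: (w j); rewrite addr0 add0r.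
    by rewrite ffunE inE (eq_sym j) (negPf nkj); case: (w j).
  have cw : c w = 0 by move: c0; rewrite sum_star big1 ?addr0.
  by move=> x /setU1P[->//|/imsetP[j _ ->]].
apply/eqP; rewrite eqEsubset sB andbT; apply/subsetP=> u uB; apply: contraT => uS.
have: independent M (u |: star w).
  apply/forall_inP=> X CX; move/forall_inP/(_ X CX): indB; apply: contra.
  by move/subset_trans; apply; rewrite subUset sub1set uB.
move/orientM/affinely_independentP=> ind.
pose d j : R := (u j != w j)%:R.
(* The coefficients of this affine relation; at a neighbour the last sum has the single term
   [d j]. *)
pose c x : R := if x == u then 1 else
  if x == w then \sum_j d j - 1 else - \sum_(j | x j != w j) d j.
have cu : c u = 1 by rewrite /c eqxx.
have nwu : w != u by apply: contraNneq uS => <-; rewrite setU11.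
have cw : c w = \sum_j d j - 1 by rewrite /c (negPf nwu) eqxx.
have cj j : c (flip [set j] w) = - d j.
  rewrite /c ifF; last first.
    apply: contraNF uS => /eqP<-; rewrite inE; apply/orP; right.
    exact: imset_f.
  rewrite ifF; last first.
    by rewrite (cube_neq (k := j)) // ffunE set11; case: (w j).
  congr (- _); rewrite (big_pred1 j) // => k; rewrite ffunE inE.
  by rewrite /=; case: (k == j); case: (w k).
have sumE (F : cube n -> R) :
    \sum_(x in u |: star w) F x = F u + (F w + \sum_j F (flip [set j] w)).
  by rewrite big_setU1 //= sum_star.
have tot : \sum_(x in u |: star w) c x = 0.
  by rewrite sumE cu cw (eq_bigr _ (fun j _ => cj j)) sumrN; ring.
have opp i : \sum_(x in u |: star w | x i == ~~ w i) c x = 0.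
  rewrite big_mkcondr sumE (bigD1 i) //= big1 => [|k nki].
    rewrite cu cj ffunE set11 /d; case: (w i); case: (u i) => /=; ring.
  by rewrite ffunE inE (eq_sym i) (negPf nki); case: (w i).
have: c u = 0.
  apply: (ind c) => // [i b|]; last by rewrite setU11.
  have [->|nb] := eqVneq b (~~ w i); first exact: opp.
  have -> : b = w i by case: (b) nb; case: (w i).
  move: tot; rewrite (bigID (fun x : cube n => x i == w i)) /=.
  rewrite [X in _ + X](eq_bigl (fun x => (x \in u |: star w) && (x i == ~~ w i))).
    by rewrite opp addr0.
  by move=> x; congr andb; case: (x i); case: (w i).
by rewrite cu => /eqP; rewrite oner_eq0.
Qed.

Lemma facet_underlying_cocircuit b i : underlying_cocircuit M (facet b i).
Proof.
apply/minsetP; split=> [|D' meetD' sD'].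
  apply/forall_inP=> B /maxsetP[indB maxB]; apply/negP=> /eqP B0.
  (* Any vertex of the facet serves: being alone there, it can be added to a basis missing the
     facet. *)
  pose v : cube n := [ffun=> b].
  have vF : v \in facet b i by rewrite inE ffunE.
  have vB : v \notin B.
    by apply/negP=> vB; move/setP/(_ v): B0; rewrite in_setI vB vF inE.
  suff /maxB/(_ (subsetUr _ _)) eB : independent M (v |: B).
    by rewrite -eB setU11 in vB.
  apply/orientM/affinely_independentP=> c c0 ci.
  have cv : c v = 0.
    rewrite -[RHS](ci i b) (big_pred1 v) // => x.
    rewrite in_setU1 /=; have [->|nxv] := eqVneq x v; first by rewrite ffunE !eqxx.
    by move/setP/(_ x): B0; rewrite !inE.
  have ind := affinely_independentP B; move/orientM/ind: indB => {}ind.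
  move=> x /setU1P[->//|xB]; apply: (ind c) xB.
    by move: c0; rewrite big_setU1 //= cv add0r.
  move=> j b'; have := ci j b'; rewrite big_mkcondr big_setU1 //= cv.
  by case: (_ == _); rewrite add0r -big_mkcondr.
apply/eqP; rewrite eqEsubset sD'; apply/subsetP=> v vF.
(* The star of the vertex opposite [v] in direction [i] meets the facet only at [v]. *)
have /forall_inP/(_ _ (star_basis (flip [set i] v)))/set0Pn[x] := meetD'.
case/setIP=> xS xD'; have := subsetP sD' x xD'.
rewrite inE in vF; rewrite inE; case/setU1P: xS xD' => [->|/imsetP[j _ ->]].
  by rewrite ffunE set11 (eqP vF); case: (b).
have [->|nji] := eqVneq j i; first by rewrite flipK.
by rewrite !ffunE !inE eqxx (eq_sym i) (negPf nji) (eqP vF); case: (b).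
Qed.

Lemma facet_cocircuit b i :
  exists P, (facet b i :&: P, facet b i :\: P) \in cocircuits M.
Proof.
have [|X CX v|P orthP] := @orthogonal_signature _ M (facet b i).
- move=> v w; rewrite !inE => /eqP vi /eqP wi nvw.
  (* The rectangle spanned by direction [i] and the coordinates where [v] and [w] differ meets the
     facet exactly in these two vertices. *)
  pose J := [set j | v j != w j].
  have iJ : i \notin J by rewrite inE vi wi eqxx.
  have [|||X CX eX] := @rectangle_circuit v [set i] J.
  + by apply/set0Pn; exists i; rewrite set11.
  + apply: contra nvw => /eqP J0.
    by rewrite -(flip_diff v w) -/J J0 flip0.
  + by rewrite disjoints1.
  exists X => //; rewrite eX -vi supp_rectangle_facet ?set11 ?disjoints1 //.
  by rewrite flip_diff.
- exact: circuit_facet.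
exists P; rewrite inE /supp /= setID facet_underlying_cocircuit /=.
rewrite -setI_eq0 setIDA setIAC -setIDA setDv setI0 eqxx /=.
by apply/forall_inP.
Qed.

End CubeMatroid.

(** * Sign functions on the vertices, modulo reorientation *)

Section Signs.
Variable n : nat.
Implicit Types (v w x y : cube n) (I J : {set 'I_n}).

Lemma flipC I J v : flip I (flip J v) = flip J (flip I v).
Proof. by apply/ffunP=> i; rewrite !ffunE addbCA. Qed.

(* [s] plays the part of the signs of the circuit on the rectangle [v, I, J]. *)
Lemma coherent_signs (g : 'I_n -> cube n -> bool) (k : 'I_n) :
    (forall v I J, I != set0 -> J != set0 -> [disjoint I & J] ->
     exists s : cube n -> bool,
       [/\ {in I, forall i, s v (+) s (flip J v) = ~~ (g i v (+) g i (flip J v))},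
           {in I, forall i, s (flip I v) (+) s (flip J (flip I v)) =
              ~~ (g i (flip I v) (+) g i (flip J (flip I v)))},
           {in J, forall j, s v (+) s (flip I v) = ~~ (g j v (+) g j (flip I v))}
         & {in J, forall j, s (flip J v) (+) s (flip J (flip I v)) =
              ~~ (g j (flip J v) (+) g j (flip J (flip I v)))}]) ->
  exists a : cube n -> bool,
    forall i x y, x i = y i -> g i x (+) a x = g i y (+) a y.
Proof.
move=> rect.
(* The signs [g i] after reorientation by [g k]. *)
pose h i x := g i x (+) g k x.
have h_flip i v J : i \notin J -> k \notin J -> h i (flip J v) = h i v.
  move=> iJ kJ; have [->|J0] := eqVneq J set0; first by rewrite flip0.
  have dIJ : [disjoint [set i; k] & J].
    rewrite -setI_eq0; apply/eqP/setP=> x; rewrite !inE.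
    by apply/negbTE/negP=> /andP[/orP[]/eqP->]; apply/negP.
  have [|s [sI _ _ _]] := rect v [set i; k] J _ J0 dIJ.
    by apply/set0Pn; exists i; rewrite set21.
  have := sI k (set22 _ _); rewrite (sI i (set21 _ _)) /h.
  by case: (g i v); case: (g i _); case: (g k v); case: (g k _).
have h_flip_k i v I : i != k -> k \notin I ->
    h i (flip I v) (+) h i (flip I (flip [set k] v)) =
    h i v (+) h i (flip [set k] v).
  move=> nik kI; have [iI|iI] := boolP (i \in I); last by rewrite !(h_flip i _ I).
  have [|||s [s1 s2 s3 s4]] := rect v I [set k].
  - by apply/set0Pn; exists i.
  - by apply/set0Pn; exists k; rewrite set11.
  - by rewrite disjoint_sym disjoints1.
  (* Adding the four edge relations modulo 2 cancels [s] and leaves the claim. *)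
  move: (s1 i iI) (s2 i iI) (s3 k (set11 k)) (s4 k (set11 k)).
  rewrite /h (flipC I).
  case: (s v); case: (s (flip I v)); case: (s (flip [set k] v));
  case: (s (flip [set k] (flip I v)));
  case: (g i v); case: (g i (flip I v)); case: (g i (flip [set k] v));
  case: (g i (flip [set k] (flip I v))) => //=;
  case: (g k v); case: (g k (flip I v)); case: (g k (flip [set k] v));
  by case: (g k (flip [set k] (flip I v))).
have [sg h_k] : exists sg : bool, forall i v, i != k ->
    h i (flip [set k] v) = h i v (+) sg.
  (* When [k] is the only direction the claim is vacuous, and [false] is a default value. *)
  have [i0 nik|all_k] := pickP (fun i => i != k); last first.
    by exists false => i v; rewrite all_k.
  pose v0 : cube n := [ffun=> false].
  have indep i j v : i != k -> j != k ->
      h i v (+) h i (flip [set k] v) = h j v (+) h j (flip [set k] v).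
    move=> nik' njk.
    have [|||s [s1 _ _ _]] := rect v [set i; j] [set k].
    - by apply/set0Pn; exists i; rewrite set21.
    - by apply/set0Pn; exists k; rewrite set11.
    - by rewrite disjoint_sym disjoints1 !inE !(eq_sym k) negb_or nik'.
    have := s1 i (set21 _ _); rewrite (s1 j (set22 _ _)) /h.
    by case: (g i v); case: (g i _); case: (g j v); case: (g j _);
       case: (g k v); case: (g k _).
  have const v : h i0 v (+) h i0 (flip [set k] v) =
      h i0 v0 (+) h i0 (flip [set k] v0).
    pose D := [set j | v j != v0 j].
    have [kD|kD] := boolP (k \in D); last first.
      by rewrite -(flip_diff v v0) -/D (flipC [set k]) h_flip_k.
    have -> : v0 = flip [set k] (flip (D :\ k) v).
      rewrite flip_flip ?setD1K ?flip_diff //.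
      by rewrite disjoints1 setD11.
    by rewrite flipK [RHS]addbC (flipC [set k]) h_flip_k // setD11.
  exists (h i0 v0 (+) h i0 (flip [set k] v0)) => i v nik'.
  by rewrite -(const v) (indep i0 i) // addbA addbb.
(* The second term reverses, when [sg] holds, the facet of direction [k] with coordinate -1. *)
exists (fun x => g k x (+) (sg && x k)) => i x y xyi.
suff: h i x (+) (sg && x k) = h i y (+) (sg && y k) by rewrite /h !addbA.
case: (eqVneq i k) xyi => [->|nik] xyi; first by rewrite /h !addbb xyi.
pose D := [set j | x j != y j].
have iD : i \notin D by rewrite inE xyi eqxx.
have [kD|kD] := boolP (k \in D); last first.
  have -> : h i y = h i x by rewrite -(h_flip i x D) // flip_diff.
  by move: kD; rewrite inE negbK => /eqP->.
(* The flips off [k] preserve [h i]; the flip of [k] adds [sg], which the second term of the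
   reorientation compensates. *)
have yE : y = flip [set k] (flip (D :\ k) x).
  by rewrite flip_flip ?setD1K ?flip_diff // disjoints1 setD11.
have -> : h i y = h i x (+) sg.
  by rewrite yE h_k // h_flip ?setD11 // in_setD1 negb_and iD orbT.
move: kD; rewrite inE; case: (x k); case: (y k) => //= _;
by case: (h i x); case: (sg).
Qed.
End Signs.

(** * Facet cocircuits against rectangle circuits *)

Section Facets.
Variables (R : realType) (n : nat) (M : oriented_matroid (cube n)).
Variable orientM : cube_orientation R M.
Implicit Types (v w x y : cube n) (I J : {set 'I_n}).

Lemma supp_rectangleC v I J : supp (rectangle v I J) = supp (rectangle v J I).
Proof. by rewrite /supp /= (setUC I J) (setUC [set flip I v]). Qed.

Lemma supp_rectangle_flip v I J : [disjoint I & J] ->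
  supp (rectangle (flip I v) I J) = supp (rectangle v I J).
Proof.
move=> dIJ; rewrite /supp /= flipK -(flip_flip _ dIJ) (flipC I J) flipK.
rewrite (flipC J I) flip_flip //; apply/setP=> x; rewrite !inE.
by do 4!case: (x == _).
Qed.

Lemma rectangle_facet_sign X Y v I J i :
    X \in circuits M -> Y \in cocircuits M -> [disjoint I & J] -> i \in I ->
    supp X = supp (rectangle v I J) -> supp Y = facet (v i) i ->
  (v \in X.1) (+) (flip J v \in X.1) = ~~ ((v \in Y.1) (+) (flip J v \in Y.1)).
Proof.
move=> CX; rewrite inE => /and3P[dY _ /forall_inP orth] dIJ iI eX eY.
apply: sorthogonal_two (circuit_disjoint CX) dY _ (orth X CX).
by rewrite eX eY supp_rectangle_facet.
Qed.

Lemma constant_facet_cocircuit (N : oriented_matroid (cube n)) b i P :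
    (facet b i :&: P, facet b i :\: P) \in cocircuits N ->
    {in facet b i &, forall x y, (x \in P) = (y \in P)} ->
  (facet b i, set0) \in cocircuits N.
Proof.
move=> CY const; have [P0|[x /setIP[xF xP]]] := set_0Vmem (facet b i :&: P).
  by move: CY; rewrite P0 (setDidPl _) -?setI_eq0 ?P0 // => /cocircuit_opp.
have sFP : facet b i \subset P.
  by apply/subsetP=> y yF; rewrite (const y x).
have FP0 : facet b i :\: P = set0 by apply/eqP; rewrite setD_eq0.
by rewrite (setIidPl sFP) FP0 in CY.
Qed.

Lemma facet_family_sub (N : oriented_matroid (cube n)) :
  (forall b i, (facet b i, set0) \in cocircuits N) ->
  facet_family n \subset cocircuits N.
Proof.
move=> CF; apply/subsetP=> Y; rewrite inE => /existsP[i /existsP[b]].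
by case/orP=> /eqP->; last apply: cocircuit_opp (CF b i).
Qed.

(** A facet cocircuit of constant sign forces a circuit to alternate along the rectangle edge in
    that facet. Conversely, any two vertices of a facet span such an edge, and an alternating
    circuit forbids a sign change of the cocircuit there. *)
Lemma facets_rectangles :
  facet_family n \subset cocircuits M <-> rectangle_family n \subset circuits M.
Proof.
split=> [facets|rects].
  have facetY b i : (facet b i, set0) \in cocircuits M.
    apply: (subsetP facets); rewrite inE; apply/existsP; exists i.
    by apply/existsP; exists b; rewrite eqxx.
  apply/subsetP=> Z; rewrite inE.
  case/existsP=> v /existsP[I /existsP[J /and4P[I0 J0 dIJ ZE]]].
  suff: rectangle v I J \in circuits M.
    by case/orP: ZE => /eqP-> // /circuit_opp.
  have [X CX eX] := rectangle_circuit orientM v I0 J0 dIJ.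
  wlog vX : X CX eX / v \in X.1.
    have: v \in supp X by rewrite eX !inE eqxx.
    move=> /setUP[vX|vX] IH; first exact: (IH X).
    by apply: (IH (sopp X)); rewrite ?supp_sopp // circuit_opp.
  have [i iI] := set0Pn _ I0; have [j jJ] := set0Pn _ J0.
  have dJI : [disjoint J & I] by rewrite disjoint_sym.
  have sign (w : cube n) (K L : {set 'I_n}) l :
      [disjoint K & L] -> l \in K -> supp X = supp (rectangle w K L) ->
      (flip L w \in X.1) = (w \notin X.1).
    move=> dKL lK eXw; have lL : l \notin L by rewrite (disjointFr dKL).
    have sY : supp (facet (w l) l, set0) = facet (w l) l by rewrite /supp setU0.
    have := rectangle_facet_sign CX (facetY (w l) l) dKL lK eXw sY.
    rewrite /= !inE flip_out // eqxx /=.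
    by case: (w \in X.1); case: (_ \in X.1).
  have sJ : (flip J v \in X.1) = (v \notin X.1) by apply: (sign v I J i).
  have sI : (flip I v \in X.1) = (v \notin X.1).
    by apply: (sign v J I j); rewrite // supp_rectangleC.
  have sIJ : (flip (I :|: J) v \in X.1) = (v \in X.1).
    rewrite setUC -(flip_flip _ dJI) (sign (flip I v) I J i) ?sI ?negbK //.
    by rewrite supp_rectangle_flip.
  have sX x : x \in supp X -> x \notin X.1 -> x \in X.2.
    by rewrite inE => /orP[->|].
  have -> : rectangle v I J = X; last by [].
  have [vS IJS IS JS] : [/\ v \in supp X, flip (I :|: J) v \in supp X,
      flip I v \in supp X & flip J v \in supp X].
    by rewrite eX !inE !eqxx !orbT.
  have X1 x : x \in X.1 -> x \in (rectangle v I J).1.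
    move=> xX; have: x \in supp X by rewrite inE xX.
    rewrite eX => /setUP[//|/set2P[]xE]; move: xX; by rewrite xE ?sI ?sJ vX.
  have X2 x : x \in X.2 -> x \in (rectangle v I J).2.
    move=> xX; have: x \in supp X by rewrite inE xX orbT.
    have xX1 := disjointFl (circuit_disjoint CX) xX.
    by rewrite eX => /setUP[/set2P[]xE|//]; rewrite xE ?sIJ vX in xX1.
  rewrite [X]surjective_pairing; congr pair; apply/setP=> x; apply/idP/idP.
  - by case/set2P=> ->; rewrite ?sIJ.
  - exact: X1.
  - by case/set2P=> ->; apply: sX; rewrite ?sI ?sJ ?vX.
  - exact: X2.
apply: facet_family_sub => b i; have [P CY] := facet_cocircuit orientM b i.
apply: (constant_facet_cocircuit CY) => x y xF yF.
have [->//|nxy] := eqVneq x y.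
pose J := [set j | x j != y j].
rewrite !inE in xF yF; have [xi yi] := (eqP xF, eqP yF).
have iJ : i \notin J by rewrite inE xi yi eqxx.
have J0 : J != set0.
  by apply: contra nxy => /eqP J0; rewrite -(flip_diff x y) -/J J0 flip0.
have yE : flip J x = y by exact: flip_diff.
have CR : rectangle x [set i] J \in circuits M.
  apply: (subsetP rects); rewrite inE.
  apply/existsP; exists x; apply/existsP; exists [set i]; apply/existsP; exists J.
  by rewrite J0 disjoints1 iJ eqxx -cards_eq0 cards1.
have sY : supp (facet b i :&: P, facet b i :\: P) = facet (x i) i.
  by rewrite /supp setID xi.
have di : [disjoint [set i] & J] by rewrite disjoints1.
have := rectangle_facet_sign CR CY di (set11 i) erefl sY.
rewrite yE /= in_set2 eqxx !inE xF yF /= => /esym.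
have -> : (y == x) = false by rewrite eq_sym (negPf nxy).
have -> : (y == flip ([set i] :|: J) x) = false.
  by rewrite (cube_neq (k := i)) // flip_in ?inE ?eqxx // xi yi; case: (b).
by case: (x \in P); case: (y \in P).
Qed.

Lemma facet_family_reorientation (k : 'I_n) :
  exists A : {set cube n}, facet_family n \subset cocircuits (reorientation A M).
Proof.
have [P CP] := fin_all_exists (fun p : bool * 'I_n =>
  facet_cocircuit orientM p.1 p.2).
(* The sign of [x] in the cocircuit chosen on the facet of direction [i] through [x]. *)
pose g i x := x \in P (x i, i).
have [v I J I0 J0 dIJ|a ga] := @coherent_signs n g k.
  have [X CX eX] := rectangle_circuit orientM v I0 J0 dIJ.
  have rel (w : cube n) (K L : {set 'I_n}) :
      [disjoint K & L] -> supp X = supp (rectangle w K L) ->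
      {in K, forall l, (w \in X.1) (+) (flip L w \in X.1) =
        ~~ (g l w (+) g l (flip L w))}.
    move=> dKL eXw l lK; have lL : l \notin L by rewrite (disjointFr dKL).
    have sY : supp (facet (w l) l :&: P (w l, l), facet (w l) l :\: P (w l, l))
        = facet (w l) l by rewrite /supp setID.
    have -> := rectangle_facet_sign CX (CP (w l, l)) dKL lK eXw sY.
    by rewrite /g !inE flip_out // eqxx.
  have dJI : [disjoint J & I] by rewrite disjoint_sym.
  (* The four relations read the same circuit from different base vertices, with [I] and [J]
     exchanged for the last two. *)
  exists (fun x => x \in X.1); split.
  - exact: rel.
  - by apply: rel; rewrite // supp_rectangle_flip.
  - by apply: rel; rewrite // supp_rectangleC.
  - by rewrite flipC; apply: rel; rewrite // supp_rectangle_flip // supp_rectangleC.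
exists [set x | a x]; apply: facet_family_sub => b i.
apply: (@constant_facet_cocircuit _ _ _ [set x | g i x (+) a x]); last first.
  by move=> x y; rewrite !inE => /eqP xi /eqP yi; apply: ga; rewrite xi yi.
rewrite cocircuits_reorientation mem_sreorient.
congr (_ \in cocircuits M): (CP (b, i)).
by congr pair; apply/setP=> x; rewrite !inE /= /g; have [<-|] := eqVneq (x i) b;
   rewrite ?andbF //=; case: (x \in _); case: (a x).
Qed.
End Facets.

Theorem theorem3p1 (R : realType) (n : nat) (n_ge1 : (1 <= n)%N)
    (M : oriented_matroid (cube n)) (orientM : cube_orientation R M) :
  (exists A : {set cube n},
     facet_family n \subset cocircuits (reorientation A M)) /\
  (forall A : {set cube n},
     facet_family n \subset cocircuits (reorientation A M) <->
     rectangle_family n \subset circuits (reorientation A M)).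
Proof.
(* The distinguished direction [k] is the first one, which exists because [n] is positive. *)
split; first exact: (facet_family_reorientation orientM (Ordinal n_ge1)).
move=> A; apply: (@facets_rectangles R) => S.
by rewrite independent_reorientation.
Qed.
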